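(* Let $c\in(0,\infty)$, $\alpha\in(0,1)$, $\eta\in(0,1)$ and $t\in\mathbb N$, and put $\ell:=\log\frac1\alpha$. Define $$\tilde u:=2c+1,\quad M:=(t-1)\tilde u+\ell,\quad u:=\frac{c+(1-\eta)M}{\eta},\quad q:=\frac{1-e^{-M}}{e^{u}-e^{-M}},\quad \tilde q:=\frac{1-e^{-1}}{e^{\tilde u}-e^{-1}}.$$ Let $\mathcal X=\{0,1\}$, $\Omega=\mathcal X^{\mathbb N}$ with the product $\sigma$-algebra, coordinates $X_1,X_2,\dots$, $\mathcal F_n=\sigma(X_1,\dots,X_n)$, and let $\mathbb P_0,\mathbb P_1$ be the laws on $\Omega$ under which the coordinates are independent with $\mathbb P_1(X_1=1)=\eta$, $\mathbb P_0(X_1=1)=q$, and, for $n\ge2$, $\mathbb P_1(X_n=1)=\frac12$, $\mathbb P_0(X_n=1)=\tilde q$. Let $\log E_1:=u$ if $X_1=1$ and $\log E_1:=-M$ if $X_1=0$; for $n\ge2$ let $\log E_n:=\tilde u$ if $X_n=1$ and $\log E_n:=-1$ if $X_n=0$. Then: (i) for every $n\in\mathbb N$, $E_n$ is a conditional e-variable for $\mathbb P_0$ at time $n$, with $\mathbb E_{\mathbb P_0}[E_n\mid\mathcal F_{n-1}]=1$; (ii) $\mathbb E_{\mathbb P_1}[\log E_n\mid\mathcal F_{n-1}]=c$ $\mathbb P_1$-a.s. for every $n\in\mathbb N$; (iii) $\bar\gamma_t(\alpha)\ge1-\eta$, and therefore also $\gamma_t(\alpha)\ge1-\eta$. Consequently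 there is no function $\Phi:(0,\infty)\times(0,1)\times\mathbb N\to[0,1)$ such that, for all $(c,\alpha,t)$, $\bar\gamma_t(\alpha)\le\Phi(c,\alpha,t)$ holds for every pair of hypotheses $(\mathbb P_0,\mathbb P_1)$ and every betting sequence $(E_n)_{n\in\mathbb N}$ satisfying $\mathbb E_{\mathbb P_1}[\log E_n\mid\mathcal F_{n-1}]\ge c$ $\mathbb P_1$-a.s. for every $n\in\mathbb N$.
   Context: General setting: $(\Omega,\mathcal F)$ is a measurable space with a filtration $(\mathcal F_t)_{t\in\mathbb N_0}$, $\mathcal F_0=\{\emptyset,\Omega\}$, and probability measures $\mathbb P_0$ (null) and $\mathbb P_1$ (alternative) such that for every $t\in\mathbb N$, $\mathbb P_1\ll\mathbb P_0$ on $\mathcal F_t$ with $\mathrm{KL}(\mathbb P_1|_{\mathcal F_t}\|\mathbb P_0|_{\mathcal F_t})<\infty$ (standing assumption); this is what ''pair of hypotheses'' means. Here $\mathbb N=\{1,2,\dots\}$, $\mathbb N_0=\mathbb N\cup\{0\}$, $\log$ is natural. A conditional e-variable for $\mathbb P_0$ at time $t$ is an $\mathcal F_t$-measurable $E_t:\Omega\to[0,\infty]$ with $\mathbb E_{\mathbb P_0}[E_t\mid\mathcal F_{t-1}]\le1$ $\mathbb P_0$-a.s.; a sequence $(E_t)_{t\in\mathbb N}$ of these is a betting sequence. Its wealth process is $W_0:=1$, $W_t:=\prod_{n\le t}E_n$. For $\alpha\in(0,1)$ the rejection time is $\tau_\alpha:=\inf\{t\in\mathbb N: W_t>\frac1\alpha\}$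 ($\inf\emptyset=\infty$). The fixed-horizon and sequential type-II errors are $\gamma_t(\alpha):=\mathbb P_1(W_t\le\frac1\alpha)$ and $\bar\gamma_t(\alpha):=\mathbb P_1(\tau_\alpha>t)=\mathbb P_1(\max_{0\le n\le t}W_n\le\frac1\alpha)$. *)

(* Defs.v *)
From HB Require Import structures.
From mathcomp Require Import all_boot all_order all_algebra finmap.
From mathcomp Require Import all_classical all_reals all_analysis.
From mathcomp Require Import measurable_realfun.

Set Implicit Arguments.
Unset Strict Implicit.
Unset Printing Implicit Defensive.

Import Order.TTheory GRing.Theory Num.Theory.
Import numFieldNormedType.Exports.

Local Open Scope classical_set_scope.
Local Open Scope ring_scope.
Local Open Scope ereal_scope.

Record filtration d (T : measurableType d) := Filtration {
  filt :> nat -> set_system T ;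
  filt_sigma_algebra : forall n, sigma_algebra [set: T] (filt n) ;
  filt_measurable : forall n, filt n `<=` measurable ;
  filt_nondecreasing : forall m n, (m <= n)%N -> filt m `<=` filt n ;
  filt_trivial : filt 0 = [set set0; [set: T]] }.

(* The restriction of P to a sub-sigma-algebra G, as a probability measure on
   the measurable space (T, G). *)
Definition restrict_to d (T : measurableType d) (R : realType)
    (G : set_system T) (GT : G `<=` measurable) (P : probability T R) :
    set (g_sigma_algebraType G) -> \bar R := P.

Section restrict_to.
Context d (T : measurableType d) (R : realType) (G : set_system T).
Variables (GT : G `<=` measurable) (P : probability T R).

Let sub (A : set (g_sigma_algebraType G)) :
  measurable A -> d.-measurable (A : set T).
Proof.
apply: smallest_sub => //; exact: sigma_algebra_measurable.
Qed.

Let restrict0 : restrict_to GT P set0 = 0.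
Proof. exact: measure0. Qed.

Let restrict_ge0 A : 0 <= restrict_to GT P A.
Proof. exact: measure_ge0. Qed.

Let restrict_semi_sigma_additive : semi_sigma_additive (restrict_to GT P).
Proof.
move=> F mF tF mUF; apply: (@measure_semi_sigma_additive _ _ _ P) => //.
- by move=> n; apply: sub.
- exact: sub.
Qed.

HB.instance Definition _ := isMeasure.Build _ _ _ (restrict_to GT P)
  restrict0 restrict_ge0 restrict_semi_sigma_additive.

Let restrictT : restrict_to GT P setT = 1.
Proof. exact: probability_setT. Qed.

HB.instance Definition _ :=
  Measure_isProbability.Build _ _ _ (restrict_to GT P) restrictT.

End restrict_to.

Definition KL d (T : measurableType d) (R : realType) (P Q : probability T R) :
    \bar R :=
  if `[< P `<< Q >]
  then \int[P]_x lne (Radon_Nikodym (charge_of_finite_measure P) Q x)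
  else +oo.

Section betting.
Context d (T : measurableType d) (R : realType).
Implicit Types (P : probability T R) (F : filtration T) (G : set_system T).

Definition pair_of_hypotheses F (P0 P1 : probability T R) :=
  forall t, (0 < t)%N ->
    let P0t := restrict_to (@filt_measurable _ _ F t) P0 in
    let P1t := restrict_to (@filt_measurable _ _ F t) P1 in
    P1t `<< P0t /\ KL P1t P0t < +oo.

Definition measurable_wrt G (f : T -> \bar R) :=
  measurable_fun [set: g_sigma_algebraType G]
    (f : g_sigma_algebraType G -> \bar R).

Definition ge0_cexp_version P G (Y Z : T -> \bar R) :=
  [/\ measurable_wrt G Z, (forall x, 0 <= Z x) &
      forall A, G A -> \int[P]_(x in A) Z x = \int[P]_(x in A) Y x].

(* Z is a version of E_P[Y | G] := E_P[Y^+ | G] - E_P[Y^- | G]; Y need not be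
   integrable, but the difference must be a.s. well-defined (no oo - oo). *)
Definition cexp_version P G (Y Z : T -> \bar R) :=
  measurable_wrt G Z /\
  exists Zp Zn : T -> \bar R,
    [/\ ge0_cexp_version P G Y^\+ Zp, ge0_cexp_version P G Y^\- Zn,
        {ae P, forall x, Zp x +? - Zn x} &
        {ae P, forall x, Z x = Zp x - Zn x}].

(* Versions are a.s. unique, so in the next three definitions it does not
   matter which one is used; [exists] includes that E_P[Y | G] is defined. *)
Definition cexp_le P G (Y : T -> \bar R) (a : \bar R) :=
  exists Z, cexp_version P G Y Z /\ {ae P, forall x, Z x <= a}.

Definition cexp_eq P G (Y : T -> \bar R) (a : \bar R) :=
  exists Z, cexp_version P G Y Z /\ {ae P, forall x, Z x = a}.

Definition cexp_ge P G (Y : T -> \bar R) (a : \bar R) :=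
  exists Z, cexp_version P G Y Z /\ {ae P, forall x, a <= Z x}.

Definition conditional_evariable F P0 (n : nat) (En : T -> \bar R) :=
  [/\ measurable_wrt (F n) En, (forall x, 0 <= En x) &
      cexp_le P0 (F n.-1) En 1].

(* Sequences indexed by {1, 2, ...} are functions on nat whose value at 0 is
   ignored. *)
Definition betting_sequence F P0 (E : nat -> T -> \bar R) :=
  forall n, (0 < n)%N -> conditional_evariable F P0 n (E n).

Definition wealth (E : nat -> T -> \bar R) (t : nat) (x : T) : \bar R :=
  \prod_(1 <= n < t.+1) E n x.

Definition rejection_time (E : nat -> T -> \bar R) (alpha : R) (x : T) :
    \bar R :=
  ereal_inf [set t%:R%:E | t in
    [set t | (0 < t)%N /\ (alpha^-1)%:E < wealth E t x]].

Definition fixed_horizon_error (P1 : probability T R) E t (alpha : R) :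
    \bar R :=
  P1 [set x | wealth E t x <= (alpha^-1)%:E].

Definition sequential_error (P1 : probability T R) E t (alpha : R) : \bar R :=
  P1 [set x | t%:R%:E < rejection_time E alpha x].

Definition mutually_independent d' (T' : measurableType d') P
    (X : nat -> T -> T') :=
  forall (J : {fset nat}) (B : nat -> set T'), (forall j, measurable (B j)) ->
    P (\bigcap_(j in [set` J]) X j @^-1` B j) =
    \prod_(j <- J) P (X j @^-1` B j).

End betting.

Definition binary_sequences : Type :=
  g_sigma_algebraType (\bigcup_i
    preimage_set_system [set: nat -> bool] (fun w => w i) measurable).

(* X_n for n >= 1; the sequences themselves are indexed from 0. *)
Definition coordinate (n : nat) (w : binary_sequences) : bool := w n.-1.

Definition coord_sigma (n : nat) : set_system binary_sequences :=
  g_sigma_preimage (fun i : 'I_n => coordinate i.+1).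

Section coord_filtration.

Let coord_sigma_algebra n : sigma_algebra [set: binary_sequences] (coord_sigma n).
Proof. exact: smallest_sigma_algebra. Qed.

Let coord_measurable n : coord_sigma n `<=` measurable.
Proof.
apply: smallest_sub; first exact: sigma_algebra_measurable.
move=> A; rewrite -bigcup_seq => -[i _ AB].
by case: AB => B mB <-; apply: sub_sigma_algebra; exists i => //; exists B.
Qed.

Let coord_nondecreasing m n :
  (m <= n)%N -> coord_sigma m `<=` coord_sigma n.
Proof.
move=> mn; apply: sub_sigma_algebra2 => A.
rewrite -!bigcup_seq/= => -[i _ AB].
exists (widen_ord mn i) => //=; exact: mem_index_enum.
Qed.

Let coord_trivial : coord_sigma 0 = [set set0; [set: binary_sequences]].
Proof.
rewrite /coord_sigma /g_sigma_preimage big_ord0; apply/seteqP; split.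
- apply: smallest_sub => //; split.
  + by left.
  + by move=> A [->|->]; rewrite ?setD0 ?setDv; [right|left].
  + move=> A h; have [[k Ak]|h'] := pselect (exists k, A k = setT).
      by right; apply/seteqP; split => // x _; exists k => //; rewrite Ak.
    left; apply/seteqP; split => // x [k _].
    by have [->|Ak] := h k; [|case: h'; exists k].
- have [s0 sC _] := smallest_sigma_algebra setT (@set0 (set binary_sequences)).
  by move=> A [->|->] //; have := sC _ s0; rewrite setD0.
Qed.

Definition coord_filtration : filtration binary_sequences :=
  Filtration coord_sigma_algebra coord_measurable coord_nondecreasing
    coord_trivial.

End coord_filtration.

Definition independent_coord_law (R : realType) (p : nat -> R)
    (P : probability binary_sequences R) :=
  mutually_independent P (fun i => coordinate i.+1) /\
  forall n, (0 < n)%N -> P [set w | coordinate n w = true] = (p n)%:E.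

Section example.
Context (R : realType).
Variables (c alpha eta : R) (t : nat).

Definition ut : R := (2 * c + 1)%R.

Definition bigM : R := ((t%:R - 1) * ut + ln (alpha^-1))%R.

Definition u : R := ((c + (1 - eta) * bigM) / eta)%R.

Definition q : R := ((1 - expR (- bigM)) / (expR u - expR (- bigM)))%R.

Definition qt : R := ((1 - expR (- 1)) / (expR ut - expR (- 1)))%R.

Definition p0 (n : nat) : R := if n == 1%N then q else qt.

Definition p1 (n : nat) : R := if n == 1%N then eta else (2^-1)%R.

Definition logE (n : nat) (w : binary_sequences) : R :=
  if n == 1%N then (if coordinate n w then u else - bigM)%R
  else (if coordinate n w then ut else - 1)%R.

Definition bet (n : nat) (w : binary_sequences) : \bar R :=
  (expR (logE n w))%:E.

End example.

(* Main.v *)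
(** The events of [coord_sigma n] are the sets that depend only on the first [n]
    coordinates, hence finite unions of cylinders on which the law is a product.
    This gives independence of the next coordinate from the past, so that
    conditional means of the bets are two-point averages; it also makes the
    Radon-Nikodym derivative of the restricted laws take finitely many values, so
    the Kullback-Leibler divergence is finite.  When the first coordinate is 0,
    the first bet costs a factor [exp (- M)] and the later bets up to time [t]
    gain at most [exp ((t - 1) ut)], which is below [exp M]; no rejection happens,
    and this event has probability [1 - eta] under the alternative.  A uniform
    bound [Phi < 1] is refuted by [eta := (1 - Phi) / 2].  The laws themselves
    exist as the law of the digits of a uniform point of [0, 1[ in the expansion
    that splits the current interval in the proportions [p n] and [1 - p n]. *)

Require Import Defs.
From mathcomp Require Import all_boot all_order all_algebra finmap.
From mathcomp Require Import all_classical all_reals all_analysis.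
From mathcomp Require Import measurable_realfun.
From mathcomp Require Import ring lra.

Import Order.TTheory GRing.Theory Num.Theory.
Local Open Scope classical_set_scope.
Local Open Scope ring_scope.
Local Open Scope ereal_scope.

Set Implicit Arguments.
Unset Strict Implicit.
Unset Printing Implicit Defensive.

(** * Events and functions determined by the first [n] coordinates *)

Definition agree (n : nat) (v w : binary_sequences) :=
  forall i, (i < n)%N -> v i = w i.

Definition atom (n : nat) (v : binary_sequences) : set binary_sequences :=
  [set w | agree n v w].

(** A canonical representative of each atom, padded with [false], so that the atoms of level [n] are
    indexed by a finite type. *)
Definition extend (n : nat) (f : {ffun 'I_n -> bool}) : binary_sequences :=
  fun i => if insub i is Some j then f j else false.

Definition truncate (n : nat) (v : binary_sequences) : {ffun 'I_n -> bool} :=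
  [ffun i : 'I_n => v i].

Lemma extend_ord (n : nat) (f : {ffun 'I_n -> bool}) (i : 'I_n) :
  extend f i = f i.
Proof. by rewrite /extend valK. Qed.

Lemma agree_extend (n : nat) (v : binary_sequences) :
  agree n (extend (truncate n v)) v.
Proof.
by move=> i ltin; rewrite (extend_ord (truncate n v) (Ordinal ltin)) ffunE.
Qed.

Lemma agree_sym (n : nat) (v w : binary_sequences) : agree n v w -> agree n w v.
Proof. by move=> vw i ltin; rewrite vw. Qed.

Lemma coordinate_coord_sigma (n i : nat) (b : bool) : (i < n)%N ->
  coord_sigma n [set w | w i = b].
Proof.
move=> ltin; apply: sub_sigma_algebra; rewrite -bigcup_seq.
exists (Ordinal ltin); first exact: mem_index_enum.
by exists [set b] => //; rewrite setTI.
Qed.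

Lemma coord_sigma_measurable (n : nat) (A : set binary_sequences) :
  coord_sigma n A -> measurable A.
Proof. exact: (@filt_measurable _ _ coord_filtration). Qed.

Lemma atom_coord_sigma (n : nat) (v : binary_sequences) :
  coord_sigma n (atom n v).
Proof.
have -> : atom n v = \bigcap_(i in `I_n) [set w | w i = v i].
  by apply/seteqP; split=> w vw i => [/vw ->|/vw <-].
apply: (@bigcap_measurableType _ (g_sigma_algebraType _)) => i ltin.
exact: coordinate_coord_sigma.
Qed.

(** Sets stable under agreement form a sigma-algebra containing the generators, which gives one
    direction. Conversely, such a set is the union of the finitely many atoms whose representative
    it contains. *)
Lemma coord_sigmaP (n : nat) (A : set binary_sequences) :
  coord_sigma n A <-> (forall v w, agree n v w -> A v -> A w).
Proof.
split.
  move: A; apply: smallest_sub.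
    split=> [//|A hA v w vw [_ nAv]|F hF v w vw [k _ Fkv]].
    - by split=> // Aw; apply: nAv; exact: hA (agree_sym vw) Aw.
    - by exists k => //; exact: hF vw Fkv.
  move=> A; rewrite -bigcup_seq => -[i _ [B mB <-]] v w vw [_ Bv].
  by split=> //; move: Bv; rewrite /= /coordinate /= vw.
move=> hA.
have -> : A = \bigcup_(f in [set f : {ffun 'I_n -> bool} | A (extend f)])
                atom n (extend f).
  apply/seteqP; split=> [v Av|v [f Af /hA]]; last exact.
  exists (truncate n v); last exact: agree_extend.
  exact: hA (agree_sym (@agree_extend _ _)) Av.
apply: (@fin_bigcup_measurable _ (g_sigma_algebraType _)) => //.
by move=> f _; exact: atom_coord_sigma.
Qed.

Lemma measurable_wrt_coordP (R : realType) (n : nat)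
    (Z : binary_sequences -> \bar R) :
  measurable_wrt (coord_sigma n) Z <-> (forall v w, agree n v w -> Z v = Z w).
Proof.
split=> [mZ v w vw|hZ _ Y mY].
  (* Singletons of the extended reals are measurable, so the level set of [Z] through [v] is an
     event of [coord_sigma n] and is stable under agreement. *)
  have : coord_sigma n (Z @^-1` [set Z v]).
    rewrite -[_ @^-1` _]setTI.
    have := mZ measurableT _ (emeasurable_set1 (Z v)).
    by apply: smallest_sub; first exact: (filt_sigma_algebra coord_filtration n).
  by move=> /coord_sigmaP /(_ v w vw erefl) ->.
rewrite setTI; apply: sub_sigma_algebra; apply/coord_sigmaP => v w vw.
by rewrite /= (hZ v w).
Qed.

(** Atoms with distinct representatives are disjoint. The extra event [B] allows conditioning on the
    next coordinate; [B = setT] gives [P A] itself. *)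
Lemma measure_atoms (R : realType) (P : probability binary_sequences R)
    (n : nat) (A B : set binary_sequences) :
  coord_sigma n A -> measurable B ->
  P (A `&` B) = \sum_(f : {ffun 'I_n -> bool} | `[< A (extend f) >])
                   P (atom n (extend f) `&` B).
Proof.
move=> /[dup] mA /coord_sigmaP hA mB.
set r := enum [pred f : {ffun 'I_n -> bool} | `[< A (extend f) >]].
have rP f : f \in r = `[< A (extend f) >] by rewrite mem_enum.
have -> : A `&` B = \bigcup_(f in [set` r]) (atom n (extend f) `&` B).
  apply/seteqP; split=> [v [Av Bv]|v [f]]; last first.
    by rewrite /= rP => /asboolP Af [/hA fv Bv]; split=> //; exact: fv.
  exists (truncate n v); last by split=> //; exact: agree_extend.
  by rewrite /= rP; apply/asboolP; exact: hA (agree_sym (@agree_extend _ _)) Av.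
rewrite measure_fin_bigcup//.
- by rewrite -fsbig_seq ?enum_uniq// big_enum.
- move=> f g _ _ [v [[fv _] [gv _]]].
  by apply/ffunP => i; rewrite -!extend_ord fv// gv.
- move=> f _; apply: measurableI => //.
  by apply: (@coord_sigma_measurable n); exact: atom_coord_sigma.
Qed.

(** * Product form of the law and independence from the past *)

Definition bern (R : realType) (x : R) (b : bool) : R :=
  if b then x else (1 - x)%R.

Lemma measurable_coordinate (i : nat) (b : bool) :
  measurable [set w : binary_sequences | w i = b].
Proof.
apply: (@coord_sigma_measurable i.+1); exact: coordinate_coord_sigma.
Qed.

Section independent_coord_law.
Context (R : realType) (p : nat -> R) (P : probability binary_sequences R).
Hypothesis lawP : independent_coord_law p P.

(** Position [i] of a sequence is the coordinate numbered [i.+1], hence the parameter [p i.+1]. *)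
Lemma law_coordinate (i : nat) (b : bool) :
  P [set w | w i = b] = (bern (p i.+1) b)%:E.
Proof.
have Pt : P [set w | w i = true] = (p i.+1)%:E by exact: lawP.2 i.+1 isT.
case: b => //.
have -> : [set w : binary_sequences | w i = false] = ~` [set w | w i = true].
  by apply/seteqP; split=> w /=; case: (w i).
by rewrite probability_setC ?Pt//; exact: measurable_coordinate.
Qed.

Lemma law_atom (n : nat) (v : binary_sequences) :
  P (atom n v) = (\prod_(i < n) bern (p i.+1) (v i))%:E.
Proof.
pose J := seq_fset tt (iota 0 n).
have Jn j : (j \in J) = (j < n)%N by rewrite seq_fsetE mem_iota.
have := lawP.1 J (fun j => [set v j]) (fun j => I).
have -> : \bigcap_(j in [set` J]) (coordinate j.+1 @^-1` [set v j]) = atom n v.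
  apply/seteqP; split=> w vw j.
    by rewrite -Jn => /vw/esym.
  by rewrite /= Jn => /vw/esym.
move=> ->; rewrite -prodEFin -(big_mkord xpredT (fun i => (bern (p i.+1) (v i))%:E)).
rewrite /index_iota subn0 (perm_big (iota 0 n)) /=.
  by apply: eq_bigr => i _; exact: law_coordinate.
by apply: uniq_perm; rewrite ?iota_uniq ?(fset_uniq J)// => j; rewrite mem_iota -Jn.
Qed.

Lemma atom_gt0 (n : nat) (v : binary_sequences) :
  (forall i, (0 < p i.+1 < 1)%R) -> 0 < P (atom n v).
Proof.
move=> p01; rewrite law_atom lte_fin; apply: prodr_gt0 => i _.
by rewrite /bern; case: ifP => _; have := p01 i; lra.
Qed.

(** Fixing coordinate [n] inside an atom of level [n] yields an atom of level [n.+1], whose product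
    has exactly one more factor. Summing over the atoms in [A] gives the claim. *)
Lemma independent_past (n : nat) (A : set binary_sequences) (b : bool) :
  coord_sigma n A ->
  P (A `&` [set w | w n = b]) = P A * (bern (p n.+1) b)%:E.
Proof.
move=> mA; rewrite (measure_atoms P mA (measurable_coordinate n b)).
rewrite -[in RHS](setIT A) (measure_atoms P mA measurableT).
rewrite ge0_sume_distrl; last by move=> f _; exact: measure_ge0.
apply: eq_bigr => f _; rewrite setIT.
set v := extend f; pose v' : binary_sequences := fun i => if i == n then b else v i.
have -> : atom n v `&` [set w | w n = b] = atom n.+1 v'.
  apply/seteqP; split=> w.
    move=> [vw wb] i; rewrite ltnS leq_eqVlt /v'.
    by case: eqP => [->|_ /vw].
  move=> vw; split=> [i ltin|]; last by rewrite /= -vw// /v' eqxx.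
  by rewrite -(vw i (ltnW ltin)) /v' (ltn_eqF ltin).
rewrite !law_atom big_ord_recr/= EFinM /v' eqxx; congr (_%:E * _).
by apply: eq_bigr => i _; rewrite ltn_eqF.
Qed.

End independent_coord_law.

(** * Conditional expectation of a function of the next coordinate *)

Section conditional_expectation.
Context (R : realType) (p : nat -> R) (P : probability binary_sequences R).
Hypothesis lawP : independent_coord_law p P.

Let mean (f : bool -> R) (n : nat) : R :=
  (p n.+1 * f true + (1 - p n.+1) * f false)%R.

Lemma integral_next_coordinate (f : bool -> R) (n : nat)
    (A : set binary_sequences) :
  (forall b, 0 <= f b)%R -> coord_sigma n A ->
  \int[P]_(w in A) (f (w n))%:E = (mean f n)%:E * P A.
Proof.
move=> f0 nA; have mA := coord_sigma_measurable nA.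
pose Ab b := A `&` [set w : binary_sequences | w n = b].
have mAb b : measurable (Ab b).
  by apply: measurableI => //; exact: measurable_coordinate.
have intAb b : \int[P]_(w in Ab b) (f (w n))%:E
    = (f b)%:E * (P A * (bern (p n.+1) b)%:E).
  have <- : P (Ab b) = P A * (bern (p n.+1) b)%:E by exact: independent_past.
  rewrite -integral_cst//; apply: eq_integral => w.
  by rewrite inE => -[_ /= ->].
have AE : A = Ab true `|` Ab false.
  by rewrite -setIUr; apply/seteqP; split=> [w Aw|w []//]; split=> //=; case: (w n); [left|right].
rewrite [in LHS]AE ge0_integral_setU//=.
- rewrite !intAb /mean /bern.
  have : P A \is a fin_num by exact: fin_num_measure.
  by case: (P A) => // r _; rewrite -!EFinM -EFinD; congr EFin; ring.
- rewrite -AE => _ Y mY.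
  have -> : A `&` (fun w : binary_sequences => (f (w n))%:E) @^-1` Y =
    \bigcup_(b in [set b | Y (f b)%:E]) Ab b.
    apply/seteqP; split=> [w [Aw Yw]|w [b Yb [Aw wb]]].
      by exists (w n).
    by split=> //=; rewrite wb.
  by apply: fin_bigcup_measurable => // b _; exact: mAb.
- by move=> w _; rewrite lee_fin.
- by apply/disj_setPS => w [[_ /= wt] [_]]; rewrite /= wt.
Qed.

Hypothesis p01 : forall i, (0 <= p i.+1 <= 1)%R.

Lemma ge0_cexp_next_coordinate (f : bool -> R) (n : nat) :
  (forall b, 0 <= f b)%R ->
  ge0_cexp_version P (coord_sigma n) (fun w => (f (w n))%:E)
    (fun=> (mean f n)%:E).
Proof.
move=> f0; split; first exact/measurable_wrt_coordP.
  move=> _; rewrite lee_fin /mean; have /andP[p0 p1] := p01 n.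
  by rewrite addr_ge0// mulr_ge0// subr_ge0.
move=> A mA; rewrite integral_next_coordinate// integral_cst//.
exact: coord_sigma_measurable mA.
Qed.

(** Positive and negative parts are again functions of the next coordinate, so both have constant
    finite conditional means. Their difference is well-defined and equals the mean of [f] by
    linearity. *)
Lemma cexp_next_coordinate (f : bool -> R) (n : nat) :
  cexp_eq P (coord_sigma n) (fun w => (f (w n))%:E) (mean f n)%:E.
Proof.
pose fp b := Num.max (f b) 0%R; pose fn b := Num.max (- f b)%R 0%R.
exists (fun=> (mean f n)%:E); split; last exact: aeW.
split; first exact/measurable_wrt_coordP.
exists (fun=> (mean fp n)%:E), (fun=> (mean fn n)%:E); split.
- have -> : (fun w : binary_sequences => (f (w n))%:E)^\+ = (fun w => (fp (w n))%:E).
    by apply/funext => w; rewrite funeposE /fp EFin_max.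
  by apply: ge0_cexp_next_coordinate => b; rewrite le_max lexx orbT.
- have -> : (fun w : binary_sequences => (f (w n))%:E)^\- = (fun w => (fn (w n))%:E).
    by apply/funext => w; rewrite funenegE /fn EFin_max.
  by apply: ge0_cexp_next_coordinate => b; rewrite le_max lexx orbT.
- exact: aeW.
- apply: aeW => _; rewrite -EFinB; congr EFin.
  have fE b : (f b = fp b - fn b)%R.
    by rewrite /fp /fn; case: (leP 0%R (f b)) => ?; case: leP => ?; lra.
  by rewrite /mean !fE; ring.
Qed.

End conditional_expectation.

(** * Absolute continuity and finite divergence *)

(** Every atom has positive mass under [P0], so the only null event at time [t] is empty and
    domination follows. The density is constant on atoms, hence bounded by some [C], and
    [lne f <= f <= C] bounds the divergence. *)
Lemma pair_of_hypotheses_coord (R : realType) (p : nat -> R)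
    (P0 P1 : probability binary_sequences R) :
  independent_coord_law p P0 -> (forall i, (0 < p i.+1 < 1)%R) ->
  pair_of_hypotheses coord_filtration P0 P1.
Proof.
move=> lawP0 p01 t _.
set P0t := restrict_to _ P0; set P1t := restrict_to _ P1.
(* Measurability in the restricted space refers to the sigma-algebra generated by [coord_sigma t],
   which is [coord_sigma t] again. *)
have coord_sub A : <<s coord_sigma t >> A -> coord_sigma t A.
  by apply: smallest_sub; first exact: (filt_sigma_algebra coord_filtration t).
have dom : P1t `<< P0t.
  apply/null_content_dominatesP => A /coord_sub mA PA0.
  suff -> : A = set0 by exact: measure0.
  apply/seteqP; split=> // v Av.
  have : P0 (atom t v) <= P0 A.
    apply: le_measure.
    - by rewrite inE; apply: (@coord_sigma_measurable t); exact: atom_coord_sigma.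
    - by rewrite inE; exact: (@coord_sigma_measurable t).
    - by move=> w vw; exact: (coord_sigmaP t A).1 mA v w vw Av.
  rewrite leNgt; have -> : P0 A = 0 by [].
  by rewrite (atom_gt0 lawP0).
split=> //; rewrite /KL asboolT//.
set f := Radon_Nikodym _ _.
have f_coord v w : agree t v w -> f v = f w.
  apply: (measurable_wrt_coordP t f).1.
  have intf : P0t.-integrable setT f by exact: Radon_Nikodym_integrable.
  exact: measurable_int intf.
have f_fin v : f v \is a fin_num by exact: Radon_Nikodym_fin_num.
(* A crude bound: the sum of the absolute values of the density over all atoms. *)
pose C : R := (\sum_(g : {ffun 'I_t -> bool}) `|fine (f (extend g))|)%R.
have fC v : f v <= C%:E.
  rewrite -[leLHS](fineK (f_fin v)) lee_fin.
  apply: le_trans (ler_norm _) _.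
  rewrite -(f_coord _ _ (@agree_extend t v)).
  rewrite /C (bigD1 (truncate t v))//= lerDl.
  by apply: sumr_ge0.
have mlnf : measurable_wrt (coord_sigma t) (fun v => lne (f v))^\+.
  by apply/measurable_wrt_coordP => v w vw; rewrite !funeposE (f_coord v w vw).
have C0 : (0 <= C)%R by exact: sumr_ge0.
rewrite integralE; apply: (@le_lt_trans _ _ (\int[P1t]_x cst C%:E x)).
  apply: (@le_trans _ _ (\int[P1t]_x (fun v => lne (f v))^\+ x)).
    by rewrite -[leRHS]sube0 leeB ?integral_ge0.
  apply: ge0_le_integral => //.
  move=> v _; rewrite funeposE ge_max lee_fin C0 andbT.
  apply: le_trans (fC v); exact/ltW/lne_sublinear.
rewrite integral_cst// [X in _ * X](_ : _ = 1) ?mule1 ?ltry//.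
exact: (@probability_setT _ _ _ P1).
Qed.

(** * Rejection time in terms of the wealth *)

Lemma lt_rejection_time d (T : measurableType d) (R : realType)
    (E : nat -> T -> \bar R) (alpha : R) (t : nat) (x : T) :
  t%:R%:E < rejection_time E alpha x <->
  forall k, (0 < k <= t)%N -> wealth E k x <= (alpha^-1)%:E.
Proof.
split=> [ltt k /andP[k0 kt]|le_wealth].
  rewrite leNgt; apply/negP => ltk; move: ltt; rewrite ltNge => /negP; apply.
  apply: (@le_trans _ _ k%:R%:E); last by rewrite lee_fin ler_nat.
  by apply: ereal_inf_lbound; exists k.
(* Times are integers, so every crossing after [t] occurs at [t.+1] or later; an infimum over no
   crossing is covered too. *)
apply: (@lt_le_trans _ _ t.+1%:R%:E); first by rewrite lte_fin ltr_nat.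
apply: le_ereal_inf_tmp => _ [k [k0 ltk] <-]; rewrite lee_fin ler_nat ltnNge.
apply/negP => kt; move: ltk; rewrite ltNge => /negP; apply.
by apply: le_wealth; rewrite k0.
Qed.

(** * Fairness, growth rate and wealth bound for the chosen parameters *)

Section example_parameters.
Context (R : realType) (c alpha eta : R) (t : nat).
Hypotheses (c0 : (0 < c)%R) (alpha01 : (0 < alpha < 1)%R)
  (eta01 : (0 < eta < 1)%R) (t0 : (0 < t)%N).

Let t1 : (1 <= t%:R :> R)%R.
Proof. by rewrite ler1n. Qed.

Lemma ln_alpha_gt0 : (0 < ln alpha^-1)%R.
Proof.
have /andP[a0 a1] := alpha01.
by rewrite ln_gt0// invf_gt1.
Qed.

Lemma ut_gt0 : (0 < ut c)%R.
Proof. by rewrite /ut; move: c0; lra. Qed.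

Lemma bigM_gt0 : (0 < bigM c alpha t)%R.
Proof.
rewrite /bigM ltr_wpDl ?ln_alpha_gt0// mulr_ge0 ?(ltW ut_gt0)//.
by rewrite subr_ge0.
Qed.

Lemma u_gt0 : (0 < u c alpha eta t)%R.
Proof.
have /andP[e0 e1] := eta01.
by rewrite /u divr_gt0// addr_gt0// mulr_gt0 ?bigM_gt0// subr_gt0.
Qed.

(** The probability [r] solves the linear equation making the payoffs [expR a] and [expR (- b)]
    average to 1. Both [q], with [u] and [bigM], and [qt], with [ut] and 1, are instances. *)
Lemma fair_probability (a b : R) (r := ((1 - expR (- b)) / (expR a - expR (- b)))%R) :
  (0 < a)%R -> (0 < b)%R ->
  (0 < r < 1)%R /\ (r * expR a + (1 - r) * expR (- b) = 1)%R.
Proof.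
move=> a0 b0.
have ea : (1 < expR a)%R by rewrite expR_gt1.
have eb : (expR (- b) < 1)%R by rewrite expR_lt1 oppr_lt0.
have ab : (0 < expR a - expR (- b))%R by lra.
split; last by rewrite /r; field; rewrite gt_eqF.
apply/andP; split; first by rewrite divr_gt0// subr_gt0.
by rewrite ltr_pdivrMr// mul1r ltrD2r.
Qed.

Lemma p0_in01 (i : nat) : (0 < p0 c alpha eta t i.+1 < 1)%R.
Proof.
rewrite /p0; case: ifP => _.
- exact: (fair_probability u_gt0 bigM_gt0).1.
- exact: (fair_probability ut_gt0 ltr01).1.
Qed.

Lemma p1_in01 (i : nat) : (0 < p1 eta i.+1 < 1)%R.
Proof. by rewrite /p1; case: ifP => _ //; lra. Qed.

(** The log-bet reads a single coordinate, so evaluating it at a constant sequence presents it as a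
    function of one bit. *)
Let logE_value (n : nat) (b : bool) : R :=
  logE c alpha eta t n.+1 (fun=> b).

Lemma bet_fair (n : nat) :
  (p0 c alpha eta t n.+1 * expR (logE_value n true) +
   (1 - p0 c alpha eta t n.+1) * expR (logE_value n false) = 1)%R.
Proof.
rewrite /p0 /logE_value /logE /=; case: ifP => _.
- exact: (fair_probability u_gt0 bigM_gt0).2.
- exact: (fair_probability ut_gt0 ltr01).2.
Qed.

(** The value [u] is the solution of [eta * u - (1 - eta) * bigM = c], and [ut] that of
    [(ut - 1) / 2 = c]. *)
Lemma log_growth (n : nat) :
  (p1 eta n.+1 * logE_value n true + (1 - p1 eta n.+1) * logE_value n false = c)%R.
Proof.
rewrite /p1 /logE_value /logE /=; case: ifP => _; last by rewrite /ut; field.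
have /andP[e0 _] := eta01.
by rewrite /u; field; rewrite gt_eqF.
Qed.

(** The first bet contributes [- bigM], and each of the [k] later ones contributes at most [ut]. *)
Lemma sum_logE_le (w : binary_sequences) (k : nat) : w 0%N = false ->
  (\sum_(1 <= n < k.+2) logE c alpha eta t n w <=
   k%:R * ut c - bigM c alpha t)%R.
Proof.
move=> w0; elim: k => [|k IHk].
  by rewrite big_nat1 /logE /= /coordinate /= w0 mul0r add0r.
rewrite big_nat_recr//= -natr1 mulrDl mul1r addrAC lerD// /logE /=.
by case: ifP => // _; rewrite /ut; move: c0; lra.
Qed.

Lemma wealth_bet (w : binary_sequences) (k : nat) :
  wealth (bet c alpha eta t) k w =
  (expR (\sum_(1 <= n < k.+1) logE c alpha eta t n w))%:E.
Proof. by rewrite /wealth prodEFin expR_sum. Qed.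

(** At most [t - 1] bets follow the first, so the log-wealth is at most
    [(t - 1) * ut - bigM = - ln (1 / alpha)], which is below [ln (1 / alpha)]. *)
Lemma wealth_bet_le (w : binary_sequences) (k : nat) :
  w 0%N = false -> (0 < k <= t)%N ->
  wealth (bet c alpha eta t) k w <= (alpha^-1)%:E.
Proof.
case: k => // k w0 /= kt; have /andP[a0 _] := alpha01.
rewrite wealth_bet lee_fin -[leRHS]lnK ?posrE ?invr_gt0// ler_expR.
apply: le_trans (sum_logE_le _ w0) _; rewrite /bigM.
have kt' : (k%:R + 1 <= t%:R :> R)%R by rewrite natr1 ler_nat.
have kut : (k%:R * ut c <= (t%:R - 1) * ut c)%R.
  by rewrite ler_wpM2r ?(ltW ut_gt0)// lerBrDr.
have := ln_alpha_gt0; lra.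
Qed.

End example_parameters.

(** * E-variables, growth and type-II errors of the example *)

Section example_bounds.
Context (R : realType) (c alpha eta : R) (t : nat).
Hypotheses (c0 : (0 < c)%R) (alpha01 : (0 < alpha < 1)%R)
  (eta01 : (0 < eta < 1)%R) (t0 : (0 < t)%N).
Context (P0 P1 : probability binary_sequences R).
Hypotheses (lawP0 : independent_coord_law (p0 c alpha eta t) P0)
  (lawP1 : independent_coord_law (p1 eta) P1).

Let E := bet c alpha eta t.

Lemma bet_depends (n : nat) (w : binary_sequences) :
  E n.+1 w = (expR (logE c alpha eta t n.+1 (fun=> w n)))%:E.
Proof. by []. Qed.

Lemma bet_agree (n : nat) (v w : binary_sequences) :
  agree n.+1 v w -> E n.+1 v = E n.+1 w.
Proof. by move=> vw; rewrite !bet_depends vw. Qed.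

Lemma wealth_agree (k : nat) (v w : binary_sequences) :
  agree k v w -> wealth E k v = wealth E k w.
Proof.
move=> vw; rewrite /wealth big_nat_cond [RHS]big_nat_cond.
apply: eq_bigr => -[//|n] /andP[/andP[_ nk] _]; apply: bet_agree => i ltin.
by apply: vw; exact: leq_trans ltin nk.
Qed.

Lemma cexp_bet (n : nat) : (0 < n)%N ->
  cexp_eq P0 (coord_filtration n.-1) (E n) 1.
Proof.
case: n => // n _; rewrite -[1]/(1%:E) -(bet_fair c0 alpha01 eta01 t0 n).
apply: (cexp_next_coordinate lawP0 _ (fun b => expR (logE c alpha eta t n.+1 (fun=> b)))).
by move=> i; have /andP[/ltW -> /ltW ->] := p0_in01 c0 alpha01 eta01 t0 i.
Qed.

Lemma bet_evariable (n : nat) : (0 < n)%N ->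
  conditional_evariable coord_filtration P0 n (E n).
Proof.
move=> n0; split.
- by case: n n0 => // n _; apply/measurable_wrt_coordP; exact: bet_agree.
- by move=> w; rewrite lee_fin expR_ge0.
- have [Z [EZ Z1]] := cexp_bet n0; exists Z; split => //.
  by apply: filterS Z1 => w /= ->.
Qed.

Lemma cexp_log_bet (n : nat) : (0 < n)%N ->
  cexp_eq P1 (coord_filtration n.-1) (fun w => lne (E n w)) c%:E.
Proof.
case: n => // n _; rewrite -[in c%:E](log_growth c alpha t eta01 n).
have -> : (fun w => lne (E n.+1 w)) =
    (fun w => (logE c alpha eta t n.+1 (fun=> w n))%:E).
  by apply/funext => w; rewrite bet_depends lne_EFin ?expR_gt0// expRK.
apply: (cexp_next_coordinate lawP1 _ (fun b => logE c alpha eta t n.+1 (fun=> b))).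
by move=> i; have /andP[/ltW -> /ltW ->] := p1_in01 eta01 i.
Qed.

Let P1_first : P1 [set w | w 0%N = false] = (1 - eta)%:E.
Proof. exact: law_coordinate lawP1 0%N false. Qed.

Lemma sequential_error_ge : (1 - eta)%:E <= sequential_error P1 E t alpha.
Proof.
rewrite -P1_first; apply: le_measure; rewrite ?inE.
- exact: measurable_coordinate.
(* Monotonicity of [P1] requires the no-rejection event to be measurable: it depends only on the
   wealth up to time [t], hence on the first [t] coordinates. *)
- apply: (@coord_sigma_measurable t); apply/coord_sigmaP => v w vw /=.
  move=> /lt_rejection_time hv; apply/lt_rejection_time => k /andP[k0 kt].
  rewrite -(@wealth_agree k v) ?hv ?k0// => i ltik.
  by apply: vw; exact: leq_trans ltik kt.
- by move=> w w0; apply/lt_rejection_time => k; exact: wealth_bet_le.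
Qed.

Lemma fixed_horizon_error_ge :
  (1 - eta)%:E <= fixed_horizon_error P1 E t alpha.
Proof.
rewrite -P1_first; apply: le_measure; rewrite ?inE.
- exact: measurable_coordinate.
- apply: (@coord_sigma_measurable t); apply/coord_sigmaP => v w vw /=.
  by rewrite (wealth_agree vw).
- by move=> w w0; apply: wealth_bet_le => //; rewrite t0 leqnn.
Qed.

End example_bounds.

(** * From atom probabilities to independent coordinates *)

Section law_of_atoms.
Context (R : realType) (p : nat -> R) (P : probability binary_sequences R).
Hypothesis P_atom : forall n v,
  P (atom n v) = (\prod_(i < n) bern (p i.+1) (v i))%:E.

Let mass (i : nat) (B : set bool) : R :=
  (\sum_(b | `[< B b >]) bern (p i.+1) b)%R.

Let massT (i : nat) : mass i setT = 1%R.
Proof.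
rewrite /mass (eq_bigl xpredT) => [|b]; last by rewrite asboolT.
by rewrite big_bool /bern/= addrC subrK.
Qed.

(** The event is a union of atoms; distributing the product of the sums [mass] over all choices of
    bits gives the sum of their probabilities. *)
Let prob_product (n : nat) (C : nat -> set bool) :
  P [set w | forall i, (i < n)%N -> C i (w i)] = (\prod_(i < n) mass i (C i))%:E.
Proof.
set A := [set w | _].
have nA : coord_sigma n A.
  by apply/coord_sigmaP => v w vw Av i ltin; rewrite -vw//; exact: Av.
rewrite -(setIT A) (measure_atoms P nA measurableT).
rewrite /mass bigA_distr_big_dep -sumEFin; apply: eq_big => [f|f _].
  apply/asboolP/familyP => [Af i|Af i ltin].
    by rewrite unfold_in; apply/asboolP; rewrite -extend_ord; exact: Af.
  by have /asboolP := Af (Ordinal ltin); rewrite -extend_ord.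
rewrite setIT P_atom; congr EFin.
by apply: eq_bigr => i _; rewrite extend_ord.
Qed.

Let prob_bigcap (J : {fset nat}) (B : nat -> set bool) :
  P (\bigcap_(j in [set` J]) coordinate j.+1 @^-1` B j) =
  (\prod_(j <- J) mass j (B j))%:E.
Proof.
pose n := (\max_(j <- J) j).+1.
have Jn j : j \in J -> (j < n)%N by move=> jJ; rewrite ltnS (@leq_bigmax_seq _ _ xpredT id).
(* Coordinates outside [J] are left free; they have mass 1, so the product over the initial segment
   reduces to the one over [J]. *)
pose C j := if j \in J then B j else setT.
have -> : \bigcap_(j in [set` J]) coordinate j.+1 @^-1` B j =
    [set w | forall i, (i < n)%N -> C i (w i)].
  apply/seteqP; split=> w.
    by move=> wB i _; rewrite /C; case: ifP => // /wB.
  by move=> wC j jJ; have := wC j (Jn j jJ); rewrite /C (_ : j \in J).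
rewrite prob_product -(big_mkord xpredT (fun i => mass i (C i))); congr EFin.
rewrite (bigID (fun i => i \in J))/= [X in (_ * X)%R]big1 ?mulr1; last first.
  by move=> i /negbTE iJ; rewrite /C iJ massT.
rewrite -big_filter (perm_big J).
  by apply: eq_big_seq => i iJ; rewrite /C iJ.
apply: uniq_perm => [||j]; rewrite ?(filter_uniq, iota_uniq) ?fset_uniq//.
rewrite mem_filter mem_index_iota /=; by apply/idP/idP => [/andP[]//|jJ]; rewrite jJ Jn.
Qed.

Lemma law_of_atoms : independent_coord_law p P.
Proof.
have marginal j (B : set bool) : P (coordinate j.+1 @^-1` B) = (mass j B)%:E.
  have := prob_bigcap [fset j]%fset (fun=> B).
  rewrite big_seq_fset1 => <-; congr (P _).
  apply/seteqP; split=> w wB; last by apply: wB; rewrite /= inE.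
  by move=> i; rewrite /= inE => /eqP ->.
split=> [J B _|[//|n] _].
  by rewrite prob_bigcap -prodEFin; apply: eq_bigr => j _; rewrite marginal.
rewrite (marginal n [set true]) /mass (bigD1 true)/= ?asboolT//.
by rewrite big1 ?addr0// => -[] /andP[/asboolP].
Qed.

End law_of_atoms.

(** * Digits of a point of the unit interval *)

Section digit_expansion.
Context (R : realType).
Implicit Types (x r : R) (p : nat -> R) (v : nat -> bool).

(** The affine map that stretches whichever of [0, r[ and [r, 1[ contains [x] onto [0, 1[. *)
Definition rescale r x : R := if (x < r)%R then (x / r)%R else ((x - r) / (1 - r))%R.

(* Digits of [x] in [0, 1[ when the [i]-th step splits the current interval in
   the proportions [p i] and [1 - p i]; under the uniform law they are
   independent Bernoulli variables. *)
Fixpoint digit p (i : nat) x : bool :=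
  if i is j.+1 then digit (p \o S) j (rescale (p 0%N) x) else (x < p 0%N)%R.

Lemma measurable_rescale r : measurable_fun [set: R] (rescale r).
Proof.
apply: measurable_fun_if => //.
- exact: measurable_fun_ltr.
- by apply: measurable_funTS; exact: measurable_funM.
- by apply: measurable_funTS; apply: measurable_funM => //; exact: measurable_funB.
Qed.

Lemma measurable_digit p (i : nat) : measurable_fun [set: R] (digit p i).
Proof.
elim: i p => [|i IHi] p /=; first exact: measurable_fun_ltr.
exact: (measurableT_comp (IHi _) (@measurable_rescale _)).
Qed.

(** Induction on the number of digits: the interval for the remaining digits is pulled back by the
    affine branch of [rescale] that the first digit selects, which multiplies its length by
    [bern (p 0) (v 0)]. *)
Lemma digit_interval p v (n : nat) (w := (\prod_(i < n) bern (p i) (v i))%R) :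
  (forall i, 0 < p i < 1)%R ->
  exists l, [/\ (0 <= l)%R, (l + w <= 1)%R, (0 <= w)%R &
    forall x, ((0 <= x < 1)%R /\ forall i, (i < n)%N -> digit p i x = v i) <->
      (l <= x < l + w)%R].
Proof.
rewrite {}/w; elim: n p v => [|n IHn] p v p01.
  by exists 0%R; rewrite big_ord0 add0r; split=> // x; split=> [[]|->].
have [l [l0 lw w0 lP]] := IHn (p \o S) (v \o S) (fun i => p01 i.+1).
set w := (\prod_(i < n) _)%R in lw w0 lP.
have -> : (\prod_(i < n.+1) bern (p i) (v i) = bern (p 0%N) (v 0%N) * w)%R.
  by rewrite big_ord_recl.
have /andP[r0 r1] := p01 0%N; set r := p 0%N in r0 r1 *.
have r10 : (0 < 1 - r)%R by rewrite subr_gt0.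
have digitS x : (forall i, (i < n.+1)%N -> digit p i x = v i) <->
    (x < r)%R = v 0%N /\
    forall i, (i < n)%N -> digit (p \o S) i (rescale r x) = v i.+1.
  split=> [xv|[x0 xv] [//|i /xv//]].
  by split=> [|i ltin]; [exact: (xv 0%N)|exact: (xv i.+1)].
case v0 : (v 0%N) digitS => digitS; rewrite /bern.
(* First digit true: the pullback is contraction by [r]. *)
- exists (r * l)%R; rewrite -mulrDr; split.
  + by rewrite mulr_ge0// ltW.
  + nra.
  + by rewrite mulr_ge0// ltW.
  move=> x; split.
  + move=> [/andP[x0 x1] /digitS[xr xv]].
    have xE : rescale r x = (x / r)%R by rewrite /rescale xr.
    have /lP : (0 <= x / r < 1)%R /\ (forall i, (i < n)%N -> digit (p \o S) i (x / r) = v i.+1).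
      by rewrite -xE; split=> //; rewrite xE divr_ge0 ?(ltW r0)//= ltr_pdivrMr ?mul1r.
    by rewrite ler_pdivlMr// ltr_pdivrMr// ![(_ * r)%R]mulrC.
  + move=> xl; have xr : (x < r)%R by nra.
    have : (l <= x / r < l + w)%R by rewrite ler_pdivlMr// ltr_pdivrMr// ![(_ * r)%R]mulrC.
    move=> /lP[/andP[x0 x1] xv]; split; last first.
      by apply/digitS; split=> //; rewrite /rescale xr.
    by apply/andP; split; nra.
(* First digit false: the pullback contracts by [1 - r] and shifts by [r]. *)
- exists (r + (1 - r) * l)%R; rewrite -addrA -mulrDr; split.
  + by rewrite addr_ge0 ?mulr_ge0// ltW.
  + nra.
  + by rewrite mulr_ge0// ltW.
  have shiftP x : (l <= (x - r) / (1 - r) < l + w)%R =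
      (r + (1 - r) * l <= x < r + (1 - r) * (l + w))%R.
    rewrite ler_pdivlMr// ltr_pdivrMr// lerBrDl ltrBlDl.
    by rewrite ![(_ * (1 - r))%R]mulrC.
  move=> x; split.
  + move=> [/andP[x0 x1] /digitS[xr xv]].
    have xE : rescale r x = ((x - r) / (1 - r))%R by rewrite /rescale xr.
    rewrite -shiftP -xE; apply/lP; split=> //; rewrite xE.
    apply/andP; split; last by rewrite ltr_pdivrMr// mul1r ltrD2r.
    by apply: divr_ge0; [rewrite subr_ge0 leNgt xr|exact: ltW].
  + move=> xl; have xr : (x < r)%R = false by apply/negbTE; rewrite -leNgt; nra.
    move: (xl); rewrite -shiftP => /lP[_ xv]; split.
      by apply/andP; split; nra.
    by apply/digitS; split=> //; rewrite /rescale xr.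
Qed.

End digit_expansion.

(** * Existence of the laws as images of the uniform law *)

Lemma pushforward_probability d d' (T : measurableType d)
    (T' : measurableType d') (R : realType) (U : probability T R) (X : T -> T') :
  measurable_fun setT X ->
  exists P : probability T' R, forall A, P A = U (X @^-1` A).
Proof.
by move=> mX; exists (distribution U (mfun_Sub (mem_set mX))).
Qed.

Section existence.
Context (R : realType) (p : nat -> R).
Hypothesis p01 : forall i, (0 < p i < 1)%R.

Definition digits (x : R) : binary_sequences := fun i => digit p i x.

Lemma measurable_digits : measurable_fun [set: R] digits.
Proof.
apply: measurability => // _ [_ [i _ [B mB <-]] <-].
rewrite !setTI -comp_preimage -[X in measurable X]setTI.
exact: (measurable_digit p i).
Qed.

Lemma uniform_prob_co (l w : R) : (0 <= l)%R -> (0 <= w)%R -> (l + w <= 1)%R ->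
  uniform_prob (@ltr01 R) `[l, (l + w)%R[%classic = w%:E.
Proof.
move=> l0 w0 lw; rewrite /uniform_prob.
rewrite (eq_integral (cst 1)) => [|x]; last first.
  rewrite inE/= in_itv/= => /andP[lx xw].
  by rewrite /uniform_pdf (le_trans l0 lx) (ltW (lt_le_trans xw lw))/= subr0 invr1.
rewrite integral_cst// mul1e; apply: etrans; first exact: lebesgue_measure_itv.
(* The interval formula separates the empty interval, where [w = 0]. *)
rewrite /= lte_fin ltrDl; case: ltP => [_|w0'].
  by rewrite -EFinB addrAC subrr add0r.
by congr EFin; apply/eqP; rewrite eq_le w0 w0'.
Qed.

(** The digits describe an interval only for points of [0, 1[; the part of the preimage outside
    [I01] is null under the uniform law. *)
Lemma uniform_digits_atom (n : nat) (v : binary_sequences) :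
  uniform_prob (@ltr01 R) (digits @^-1` atom n v) =
  (\prod_(i < n) bern (p i) (v i))%:E.
Proof.
pose U : probability (measurableTypeR R) R := uniform_prob (@ltr01 R).
rewrite -[LHS]/(U (digits @^-1` atom n v)).
pose I01 : set R := `[0%R, 1%R[%classic.
have UI : U I01 = 1.
  by have := @uniform_prob_co 0 1; rewrite add0r; apply; lra.
have UIC : U (~` I01) = 0.
  rewrite probability_setC//; last exact: measurable_itv.
  by have -> : U I01 = 1 by []; rewrite -EFinB subrr.
have mA : measurable (digits @^-1` atom n v).
  rewrite -[X in measurable X]setTI; apply: measurable_digits => //.
  by apply: (@coord_sigma_measurable n); exact: atom_coord_sigma.
have [l [l0 lw w0 lP]] := digit_interval v n p01.
rewrite -(uniform_prob_co l0 w0 lw).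
have -> : `[l, (l + \prod_(i < n) bern (p i) (v i))%R[%classic =
    (digits @^-1` atom n v) `&` I01.
  apply/seteqP; split=> x /=.
    rewrite in_itv/= => /lP[x01 xv]; rewrite /I01/= in_itv/=; split=> // i ltin.
    by rewrite -xv.
  rewrite /I01/= !in_itv/= => -[xv x01]; apply/lP; split=> // i ltin.
  by rewrite xv.
have mI : measurable I01 by exact: measurable_itv.
rewrite -[RHS]/(U _) (measureDI U mA mI) setDE.
rewrite -[RHS]add0e; congr (_ + _).
apply/eqP; rewrite eq_le measure_ge0 andbT -UIC.
by apply: measureIr => //; exact: measurableC.
Qed.

(** Digits are numbered from 0 and coordinates from 1, whence the shift between [p] and [p']. *)
Lemma independent_coord_law_exists (p' : nat -> R) :
  (forall i, p' i.+1 = p i) ->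
  exists P : probability binary_sequences R, independent_coord_law p' P.
Proof.
move=> p'E.
have [P PE] := pushforward_probability (uniform_prob (@ltr01 R)) measurable_digits.
exists P; apply: law_of_atoms => n v; rewrite PE.
apply: etrans (uniform_digits_atom n v) _; congr EFin; apply: eq_bigr => i _.
by rewrite p'E.
Qed.

End existence.

(** * The example assembled, and the refutation of a uniform bound *)

Unset Implicit Arguments.

Theorem theorem3p7 (R : realType) :
  (forall (c alpha eta : R) (t : nat),
     (0 < c)%R -> (0 < alpha < 1)%R -> (0 < eta < 1)%R -> (0 < t)%N ->
     (exists P0 P1 : probability binary_sequences R,
        independent_coord_law (p0 c alpha eta t) P0 /\
        independent_coord_law (p1 eta) P1) /\
     forall P0 P1 : probability binary_sequences R,
       independent_coord_law (p0 c alpha eta t) P0 ->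
       independent_coord_law (p1 eta) P1 ->
       let F := coord_filtration in
       let E := bet c alpha eta t in
       [/\ pair_of_hypotheses F P0 P1,
           (forall n, (0 < n)%N ->
              conditional_evariable F P0 n (E n) /\
              cexp_eq P0 (F n.-1) (E n) 1),
           (forall n, (0 < n)%N ->
              cexp_eq P1 (F n.-1) (fun w => lne (E n w)) c%:E),
           (1 - eta)%:E <= sequential_error P1 E t alpha &
           (1 - eta)%:E <= fixed_horizon_error P1 E t alpha])
  /\
  ~ exists Phi : R -> R -> nat -> R,
      (forall (c alpha : R) (t : nat),
         (0 < c)%R -> (0 < alpha < 1)%R -> (0 < t)%N ->
         (0 <= Phi c alpha t < 1)%R) /\
      (forall (c alpha : R) (t : nat),
         (0 < c)%R -> (0 < alpha < 1)%R -> (0 < t)%N ->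
         forall (d : measure_display) (T : measurableType d)
           (F : filtration T) (P0 P1 : probability T R)
           (E : nat -> T -> \bar R),
           pair_of_hypotheses F P0 P1 ->
           betting_sequence F P0 E ->
           (forall n, (0 < n)%N ->
              cexp_ge P1 (F n.-1) (fun x => lne (E n x)) c%:E) ->
           sequential_error P1 E t alpha <= (Phi c alpha t)%:E).
Proof.
have bet_conclusions (c alpha eta : R) (t : nat) (P0 P1 : probability binary_sequences R) :
    (0 < c)%R -> (0 < alpha < 1)%R -> (0 < eta < 1)%R -> (0 < t)%N ->
    independent_coord_law (p0 c alpha eta t) P0 ->
    independent_coord_law (p1 eta) P1 ->
    let E := bet c alpha eta t in
    [/\ pair_of_hypotheses coord_filtration P0 P1,
        (forall n, (0 < n)%N ->
           conditional_evariable coord_filtration P0 n (E n) /\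
           cexp_eq P0 (coord_filtration n.-1) (E n) 1),
        (forall n, (0 < n)%N ->
           cexp_eq P1 (coord_filtration n.-1) (fun w => lne (E n w)) c%:E),
        (1 - eta)%:E <= sequential_error P1 E t alpha &
        (1 - eta)%:E <= fixed_horizon_error P1 E t alpha].
  move=> c0 alpha01 eta01 t0 lawP0 lawP1; split.
  - exact: pair_of_hypotheses_coord lawP0 (p0_in01 c0 alpha01 eta01 t0).
  - by move=> n n0; split; [exact: bet_evariable|exact: cexp_bet].
  - by move=> n n0; exact: cexp_log_bet.
  - exact: sequential_error_ge.
  - exact: fixed_horizon_error_ge.
have laws_exist (c alpha eta : R) (t : nat) :
    (0 < c)%R -> (0 < alpha < 1)%R -> (0 < eta < 1)%R -> (0 < t)%N ->
    exists P0 P1 : probability binary_sequences R,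
      independent_coord_law (p0 c alpha eta t) P0 /\
      independent_coord_law (p1 eta) P1.
  move=> c0 alpha01 eta01 t0.
  have [P0 lawP0] := independent_coord_law_exists (p0_in01 c0 alpha01 eta01 t0) (fun=> erefl).
  have [P1 lawP1] := independent_coord_law_exists (p1_in01 eta01) (fun=> erefl).
  by exists P0, P1.
split=> [c alpha eta t c0 alpha01 eta01 t0|[Phi [Phi01 PhiP]]].
  split; first exact: laws_exist.
  by move=> P0 P1 lawP0 lawP1; exact: bet_conclusions.
(* A single triple refutes [Phi]: [c = 1], [alpha = 1/2], [t = 1]. *)
have c0 : (0 < 1 :> R)%R by [].
have alpha01 : (0 < (2^-1 : R) < 1)%R by lra.
have Phi_lt1 := Phi01 1%R 2^-1%R 1%N c0 alpha01 isT.
set phi := Phi 1%R 2^-1%R 1%N in Phi_lt1 *.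
(* With this choice [1 - eta = (1 + phi) / 2], which exceeds [phi] because [phi < 1]. *)
pose eta : R := ((1 - phi) / 2)%R.
have eta01 : (0 < eta < 1)%R by rewrite /eta; lra.
have [P0 [P1 [lawP0 lawP1]]] := laws_exist 1%R 2^-1%R eta 1%N c0 alpha01 eta01 isT.
have [hyp ev logc seq_ge _] := 
  bet_conclusions _ _ eta 1%N _ _ c0 alpha01 eta01 isT lawP0 lawP1.
have := PhiP 1%R 2^-1%R 1%N c0 alpha01 isT _ _ _ _ _ _ hyp
  (fun n n0 => (ev n n0).1).
have log_ge n : (0 < n)%N -> cexp_ge P1 (coord_filtration n.-1)
    (fun w => lne (bet 1 2^-1 eta 1 n w)) 1%:E.
  move=> /logc[Z [LZ Zc]]; exists Z; split=> //.
  by apply: filterS Zc => w /= ->.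
move=> /(_ log_ge) /(le_trans seq_ge); rewrite lee_fin -/phi /eta; lra.
Qed.
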